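(* There is a positive integer $m$ and positive constants $C_1,C_2$ such that for each $j\in m\mathbb{Z}$ and each $(\alpha,\tau)\in K_j:=2^j\mathbb{Z}^{2n}\times2^{2j}\mathbb{Z}$ there are subsets $\mathcal{S}_{j,\alpha,\tau}$ of $\mathbb{H}^n$ satisfying: (1) for each $j\in m\mathbb{Z}$, $\mathbb{H}^n$ is the pairwise disjoint union $\bigcup_{(\alpha,\tau)\in K_j}\mathcal{S}_{j,\alpha,\tau}$; (2) $P_{\mathbb{C}^n}\mathcal{S}_{j,\alpha,\tau}=I^j_\alpha$ for $j\in m\mathbb{Z}$, $(\alpha,\tau)\in K_j$; (3) $B_d(c_{j,\alpha,\tau},C_12^j)\subset\mathcal{S}_{j,\alpha,\tau}\subset B_d(c_{j,\alpha,\tau},C_22^j)$ for $j\in m\mathbb{Z}$, $(\alpha,\tau)\in K_j$; (4) for any two such sets, either $\mathcal{S}_{j,\alpha,\tau}\subset\mathcal{S}_{j',\alpha',\tau'}$, or $\mathcal{S}_{j',\alpha',\tau'}\subset\mathcal{S}_{j,\alpha,\tau}$, or $\mathcal{S}_{j,\alpha,\tau}\cap\mathcal{S}_{j',\alpha',\tau'}=\emptyset$; (5) $c_{j,\alpha,\tau}=\left(P_{j,\alpha},\tau+\tfrac12 2^{2j}\right)$, where $P_{j,\alpha}$ is the centre of $I^j_\alpha$ and $P_{\mathbb{C}^n}$ denotes orthogonal projection of $\mathbb{H}^n$ onto $\mathbb{C}^n$.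
   Context: $\mathbb{H}^n=\mathbb{C}^n\times\mathbb{R}$ is the Heisenberg group with multiplication $(\zeta,t)\cdot(\eta,s)=(\zeta+\eta,t+s+2\operatorname{Im}(\zeta\cdot\overline\eta))$ and inverse $(\eta,s)^{-1}=(-\eta,-s)$. Put $\rho(\zeta,t)=(|\zeta|^4+t^2)^{1/4}$ and $d((\zeta,t),(\eta,s))=\rho((\zeta,t)\cdot(\eta,s)^{-1})$, a symmetric quasimetric, with balls $B_d(x,r)=\{y:d(x,y)<r\}$. With $\mathbb{C}^n\simeq\mathbb{R}^{2n}$, the usual dyadic cubes are $I^j_0=[0,2^j)^{2n}$ and $I^j_\alpha=I^j_0+\alpha$ for $j\in\mathbb{Z}$, $\alpha\in2^j\mathbb{Z}^{2n}$. *)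

(* Defs.v *)
From mathcomp Require Import all_boot all_order all_algebra.
From mathcomp Require Import complex.
From mathcomp Require Import all_classical all_reals all_analysis.

Set Implicit Arguments.
Unset Strict Implicit.
Unset Printing Implicit Defensive.

Import Order.TTheory GRing.Theory Num.Theory.

Local Open Scope classical_set_scope.
Local Open Scope ring_scope.

Section Heisenberg.
Variables (R : realType) (n : nat).

Definition heis : Type := ('rV[R[i]]_n * R)%type.

Definition hdot (z w : 'rV[R[i]]_n) : R[i] :=
  \sum_(k < n) z 0 k * conjc (w 0 k).

Definition heis_mul (p q : heis) : heis :=
  (p.1 + q.1, p.2 + q.2 + 2 * complex.Im (hdot p.1 q.1)).

Definition heis_inv (p : heis) : heis := (- p.1, - p.2).

Definition cnorm (z : 'rV[R[i]]_n) : R :=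
  Num.sqrt (\sum_(k < n) Normc.normc (z 0 k) ^+ 2).

Definition heis_rho (p : heis) : R :=
  (cnorm p.1 ^+ 4 + p.2 ^+ 2) `^ (1 / 4).

Definition heis_dist (p q : heis) : R := heis_rho (heis_mul p (heis_inv q)).

Definition heis_ball (p : heis) (r : R) : set heis :=
  [set q | heis_dist p q < r].

(* The identification of R^2n with C^n: real parts first, then imaginary
   parts.  The families of cubes below do not depend on the order chosen for
   the 2n real coordinates. *)
Definition cplx (x : 'rV[R]_(n + n)) : 'rV[R[i]]_n :=
  \row_(k < n) Complex (x 0 (lshift n k)) (x 0 (rshift n k)).

Definition cube0 (j : int) : set 'rV[R]_(n + n) :=
  [set x | forall k, 0 <= x 0 k < (2 : R) ^ j].

Definition cube (j : int) (a : 'rV[R]_(n + n)) : set 'rV[R]_(n + n) :=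
  [set x + a | x in cube0 j].

Definition cube_center (j : int) (a : 'rV[R]_(n + n)) : 'rV[R]_(n + n) :=
  a + const_mx ((2 : R) ^ j / 2).

Definition lattice (j : int) : set ('rV[R]_(n + n) * R) :=
  [set (2 : R) ^ j *: map_mx intr a | a in [set: 'rV[int]_(n + n)]] `*`
  [set (2 : R) ^ (2 * j) * b%:~R | b in [set: int]].

End Heisenberg.

(* Main.v *)
Require Import Defs.
From mathcomp Require Import all_boot all_order all_algebra.
From mathcomp Require Import complex.
From mathcomp Require Import all_classical all_reals all_analysis.
From mathcomp Require Import ring lra zify.

Set Implicit Arguments.
Unset Strict Implicit.
Unset Printing Implicit Defensive.

Import Order.TTheory GRing.Theory Num.Theory.
Import numFieldNormedType.Exports.

Local Open Scope classical_set_scope.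
Local Open Scope ring_scope.

(* Write P_j(z) for the centre of the dyadic cube of side 2^j containing z, and
   omega(z, w) = 2 Im (z . conj w).  In these terms a ball of radius 2^j
   centred above P_j(z) is a slab t ~ tau + omega(z, P_j(z)) of height 4^j.
   The tiles are slabs tau <= t - f_j(z) < tau + 4^j over a cube, with f_j(z)
   within 4^j / 4 of omega(z, P_j(z)).  Such tiles are nested as soon as
   f_(j+m) - f_j is constant on every cube of side 2^j, with values in 4^j Z.
   Now omega(z, P_(j+m)(z)) - omega(z, P_j(z)) is the sum of
   omega(P_j(z), P_(j+m)(z)), which has both properties, and of
   u_j(z) = omega(z - P_j(z), P_(j+m)(z) - P_j(z)) = O(n 2^m 4^j).  Hence
   f_j(z) = omega(z, P_j(z)) - sum_(k >= 1) u_(j - k m)(z) works, the geometric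
   series being O(n 2^-m 4^j). *)

(** * Series and integer parts *)

Lemma lim_series_recl (R : realType) (u : R^nat) : cvgn (series u) ->
  limn (series u) = u 0%N + limn (series (fun k => u k.+1)).
Proof.
move=> cu.
have -> : series (fun k => u k.+1) = (fun k => series u k.+1 - u 0%N).
  by apply/funext => k; rewrite /series/= big_nat_recl// addrAC subrr add0r.
have cu1 : series u k.+1 @[k --> \oo] --> limn (series u) by rewrite cvg_shiftS.
rewrite (cvg_lim _ (cvgB cu1 (cvg_cst (u 0%N))))//.
by rewrite addrC subrK.
Qed.

Lemma series_geometric_majorant (R : realType) (u : R^nat) (a q : R) :
  0 <= a -> 0 <= q -> q < 1 -> (forall k, `|u k| <= a * q ^+ k) ->
  cvgn (series u) /\ `|limn (series u)| <= a / (1 - q).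
Proof.
move=> a0 q0 q1 ub.
have qn : `|q| < 1 by rewrite ger0_norm.
have cg := @is_cvg_geometric_series R a q qn.
have cn : cvgn [normed series u].
  apply: (series_le_cvg _ _ _ cg) => k //=.
  by rewrite mulr_ge0// exprn_ge0.
split; first exact: normed_cvg.
apply: (le_trans (lim_series_norm cn)).
by rewrite -(cvg_lim _ (cvg_geometric_series qn))//; apply: lim_series_le.
Qed.

(** An integer [k] is at most [x / M] exactly when [k * M] is at most the floor of [x], so the
    coarse floor is determined by the fine one. *)
Lemma floor_divn_congr (R : realType) (x y : R) (M : nat) : (0 < M)%N ->
  Num.floor x = Num.floor y -> Num.floor (x / M%:R) = Num.floor (y / M%:R).
Proof.
move=> M0 xy; have M0' : 0 < M%:R :> R by rewrite ltr0n.
have key (z : R) (k : int) :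
    (k <= Num.floor (z / M%:R)) = (k * M%:Z <= Num.floor z).
  by rewrite !floor_ge_int ler_pdivlMr// intrM.
by apply/eqP; rewrite eq_le !key -xy -key lexx xy -key lexx.
Qed.

Lemma floorBz_congr (R : realType) (x y w : R) : w \is a Num.int ->
  Num.floor x = Num.floor y -> Num.floor (x - w) = Num.floor (y - w).
Proof. by move=> wint xy; rewrite !floorDrz ?rpredN// xy. Qed.

(** * The symplectic form and real coordinates on the Heisenberg group *)

Section Symplectic.
Variables (R : realType) (n : nat).
Implicit Types (x y : 'rV[R]_(n + n)).

(** The twist of the group law, twice the imaginary part of [hdot], in real coordinates. *)
Definition omega x y : R := 2 * \sum_(k < n)
  (x 0 (rshift n k) * y 0 (lshift n k) - x 0 (lshift n k) * y 0 (rshift n k)).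

Lemma Im_hdot_cplx x y :
  2 * complex.Im (hdot (cplx x) (- cplx y)) = - omega x y.
Proof.
rewrite /omega -mulrN; congr (2 * _); rewrite /hdot.
rewrite (big_morph (@complex.Im R) (id1 := 0) (op1 := +%R))//; last first.
  by case=> [? ?] [].
rewrite -sumrN; apply: eq_bigr => k _; rewrite !mxE /=; ring.
Qed.

Lemma omegaBr x y z : omega x (y - z) = omega x y - omega x z.
Proof.
rewrite /omega -mulrBr -sumrB; congr (_ * _).
by apply: eq_bigr => k _; rewrite !mxE; ring.
Qed.

Lemma omegaC x y : omega x y = - omega y x.
Proof.
rewrite /omega -mulrN -sumrN; congr (_ * _).
by apply: eq_bigr => k _; ring.
Qed.

Lemma omegaBl x y z : omega (x - y) z = omega x z - omega y z.
Proof. by rewrite omegaC omegaBr opprB (omegaC x) (omegaC y) opprK addrC. Qed.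

Lemma omega_ler x y a b :
  (forall k, `|x 0 k| <= a) -> (forall k, `|y 0 k| <= b) ->
  `|omega x y| <= 4 * n%:R * (a * b).
Proof.
move=> xa yb; rewrite /omega normrM ger0_norm//.
have -> : 4 * n%:R * (a * b) = 2 * \sum_(k < n) (a * b + a * b).
  by rewrite sumr_const card_ord -mulr_natr; ring.
rewrite ler_pM2l//; apply: (le_trans (ler_norm_sum _ _ _)).
apply: ler_sum => k _; apply: (le_trans (ler_normB _ _)).
by rewrite !normrM lerD// ler_pM.
Qed.

Definition uncplx (z : 'rV[R[i]]_n) : 'rV[R]_(n + n) :=
  row_mx (map_mx (@complex.Re R) z) (map_mx (@complex.Im R) z).

Lemma uncplxK : cancel uncplx (@cplx R n).
Proof.
move=> z; apply/rowP => k; rewrite mxE row_mxEl row_mxEr !mxE.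
by case: (z 0 k).
Qed.

Lemma cplxK : cancel (@cplx R n) uncplx.
Proof.
move=> x; rewrite -[RHS]hsubmxK; congr row_mx; apply/rowP => k; by rewrite !mxE.
Qed.

Lemma cnorm_cplx x : cnorm (cplx x) ^+ 2 = \sum_(k < n + n) x 0 k ^+ 2.
Proof.
rewrite /cnorm sqr_sqrtr; last by apply: sumr_ge0 => k _; rewrite sqr_ge0.
rewrite big_split_ord/= -big_split/=; apply: eq_bigr => k _.
by rewrite !mxE/= sqr_sqrtr// addr_ge0// sqr_ge0.
Qed.

Lemma cplxB x y : cplx (x - y) = cplx x - cplx y.
Proof. by apply/rowP => k; rewrite !mxE. Qed.

Lemma heis_dist_cplx x y s t : heis_dist (cplx x, s) (cplx y, t) =
  ((\sum_(k < n + n) (x - y) 0 k ^+ 2) ^+ 2 +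
   (s - t - omega x y) ^+ 2) `^ (1 / 4).
Proof.
rewrite /heis_dist /heis_rho /heis_mul /heis_inv/=.
by rewrite Im_hdot_cplx -cplxB -cnorm_cplx -exprM.
Qed.

(** Taking fourth roots is strictly increasing on nonnegative reals, so ball membership becomes a
    polynomial inequality. *)
Lemma heis_dist_lt x y s t (r : R) : 0 < r ->
  (heis_dist (cplx x, s) (cplx y, t) < r) =
  ((\sum_(k < n + n) (x - y) 0 k ^+ 2) ^+ 2 + (s - t - omega x y) ^+ 2 < r ^+ 4).
Proof.
move=> r0; rewrite heis_dist_cplx; set A := (X in X `^ _).
have A0 : 0 <= A by rewrite addr_ge0// sqr_ge0.
have rE : r = (r ^+ 4) `^ (1 / 4).
  rewrite -powR_mulrn ?(ltW r0)// -powRrM.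
  by rewrite (_ : 4%:R * _ = 1) ?powRr1 ?(ltW r0)//; field.
rewrite {1}rE; apply/idP/idP; last first.
  apply: gt0_ltr_powR => //; rewrite ?nnegrE// ?exprn_ge0// ltW//.
apply: contraTT; rewrite -!leNgt; apply: ge0_ler_powR => //.
by rewrite nnegrE exprn_ge0// ltW.
Qed.

End Symplectic.

(** * Dyadic cells and their centres *)

Section Tiling.
Variables (R : realType) (n m : nat).
(* Ensures 16 n <= 2 ^ m, which keeps [drift] below a quarter of the height of
   a tile. *)
Hypothesis m_ge : (n + 4 <= m)%N.
Implicit Types (j : int) (x y : 'rV[R]_(n + n)).

Definition cell j x : 'rV[int]_(n + n) := \row_k Num.floor (x 0 k / 2 ^ j).

Definition corner j (a : 'rV[int]_(n + n)) : 'rV[R]_(n + n) :=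
  (2 : R) ^ j *: map_mx intr a.

Definition center j x := cube_center j (corner j (cell j x)).

Lemma exp2z_gt0 j : 0 < (2 : R) ^ j.
Proof. exact: exprz_gt0. Qed.

Lemma exp2zM2 j : (2 : R) ^ (2 * j) = (2 ^ j) ^+ 2.
Proof. by rewrite mulrC -exprz_exp. Qed.

Lemma exp2zD j (k : nat) : (2 : R) ^ (j + k%:Z) = 2 ^ j * 2 ^+ k.
Proof. by rewrite expfzDr ?pnatr_eq0. Qed.

Lemma cellP j x a : cell j x = a <->
  forall k, 0 <= (x - corner j a) 0 k < 2 ^ j.
Proof.
have D0 := exp2z_gt0 j.
have E k : (Num.floor (x 0 k / 2 ^ j) == a 0 k) =
    (0 <= (x - corner j a) 0 k < 2 ^ j).
  rewrite floor_eq ler_pdivlMr// ltr_pdivrMr// !mxE intrD.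
  by congr (_ && _); apply/idP/idP; lra.
split=> [xa k|xa]; first by rewrite -E -xa mxE.
by apply/rowP => k; rewrite mxE; apply/eqP; rewrite E.
Qed.

Lemma center_ler j x k : `|(x - center j x) 0 k| <= 2 ^ j / 2.
Proof.
have /cellP/(_ k) : cell j x = cell j x by [].
rewrite !mxE ler_norml => /andP[]; lra.
Qed.

Lemma cell_coarser j x y : cell j x = cell j y ->
  cell (j + m%:Z) x = cell (j + m%:Z) y.
Proof.
move=> /rowP xy; apply/rowP => k; rewrite !mxE exp2zD !invfM !mulrA.
rewrite -natrX; apply: floor_divn_congr; first by rewrite expn_gt0.
by have := xy k; rewrite !mxE.
Qed.

(** * The tilted bases of the tiles *)

(* The variation, inside the cell of [x] at scale [j], of the change of slope
   [omega x (center (j + m) x - center j x)] between two consecutive scales. *)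
Definition shear j x :=
  omega (x - center j x) (center (j + m%:Z) x - center j x).

(** The sum starts at scale [j - m], so that raising [j] by [m] prepends exactly the term
    [shear j x]. Convergence, without which [limn] would be a default value, is part of
    [drift_cvg]. *)
Definition drift j x : R :=
  limn (series (fun k : nat => shear (j - (k.+1 * m)%:Z) x)).

(** The function f_j of the overview. *)
Definition tilt j x := omega x (center j x) - drift j x.

(** The entries of the first argument of [omega] are at most [2 ^ j / 2]; those of the second, a
    difference of two centres each compared with [x], are at most [2 ^ j * 2 ^+ m]. *)
Lemma shear_ler j x : `|shear j x| <= 2 * n%:R * 2 ^+ m * (2 ^ j) ^+ 2.
Proof.
have D0 := exp2z_gt0 j.
have -> : 2 * n%:R * 2 ^+ m * (2 ^ j) ^+ 2 =
    4 * n%:R * (2 ^ j / 2 * (2 ^ j * 2 ^+ m)) :> R by field.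
apply: omega_ler => k; first exact: center_ler.
have -> : (center (j + m%:Z) x - center j x) 0 k =
  (x - center j x) 0 k - (x - center (j + m%:Z) x) 0 k.
  by move: (center _ _) (center _ _) => u v; rewrite !mxE; ring.
apply: (le_trans (ler_normB _ _)).
apply: le_trans (lerD (center_ler _ _ _) (center_ler _ _ _)) _.
rewrite exp2zD.
have : 1 <= (2 : R) ^+ m by rewrite exprn_ege1// ler1n.
nra.
Qed.

(** With [M = 2 ^+ m], the terms are dominated by a geometric series of first term
    [2 * n / M * 4 ^ j], at most [4 ^ j / 8], and ratio [M ^- 2], at most 1/2. *)
Lemma drift_cvg j x :
  cvgn (series (fun k : nat => shear (j - (k.+1 * m)%:Z) x)) /\
  `|drift j x| <= (2 ^ j) ^+ 2 / 4.
Proof.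
have D0 := exp2z_gt0 j; set M : R := 2 ^+ m.
have M16 : 16 <= M by rewrite /M -natrX ler_nat (@leq_pexp2l 2 4)//; lia.
(* [2 ^ (n + 4)] is 16 times [2 ^ n], which exceeds [n]. *)
have Mn : 16 * n%:R <= M.
  rewrite /M -natrX -natrM ler_nat (leq_trans _ (leq_pexp2l _ m_ge))//.
  by rewrite addnC expnD leq_mul// ltnW// ltn_expl.
have M0 : 0 < M by lra.
have n0 : (0 : R) <= n%:R by [].
have [|||k|cu bd] := @series_geometric_majorant R
    (fun k : nat => shear (j - (k.+1 * m)%:Z) x)
    (2 * n%:R / M * (2 ^ j) ^+ 2) (M^-1 ^+ 2).
- by rewrite !mulr_ge0// ?invr_ge0 ?exprn_ge0// ltW.
- by rewrite exprn_ge0// invr_ge0 ltW.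
- by rewrite expr_lt1// ?invr_ge0 ?invf_lt1//; lra.
- apply: (le_trans (shear_ler _ _)).
  have -> : (2 : R) ^ j = 2 ^ (j - (k.+1 * m)%:Z) * (M * M ^+ k).
    by rewrite -exprS -exprM mulnC -exp2zD subrK.
  rewrite -/M le_eqVlt; apply/orP; left; apply/eqP.
  have Mk : M ^+ k != 0 by rewrite expf_neq0// gt_eqF.
  have -> : M^-1 ^+ 2 ^+ k = (M ^+ k ^+ 2)^-1 by rewrite exprAC !exprVn.
  by field; rewrite Mk gt_eqF.
split=> //; apply: (le_trans bd).
rewrite ler_pdivrMr; last first.
  by rewrite subr_gt0 expr_lt1// ?invr_ge0 ?invf_lt1//; lra.
have i0 : 0 <= M^-1 by rewrite invr_ge0 ltW.
have i1 : M^-1 <= 1 / 16 by rewrite div1r lef_pV2 ?posrE//; lra.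
have nM : n%:R / M <= 1 / 16 by rewrite ler_pdivrMr//; lra.
have DD : 0 < ((2 : R) ^ j) ^+ 2 by rewrite exprn_gt0.
have q2 : M^-1 ^+ 2 <= 1 / 2 by nra.
have := ler_wpM2r (ltW DD) nM; have := ler_wpM2r (ltW DD) q2; lra.
Qed.

Lemma drift_coarser j x : drift (j + m%:Z) x = shear j x + drift j x.
Proof.
rewrite /drift lim_series_recl; last by have [] := drift_cvg (j + m%:Z) x.
congr (_ + limn (series _)); first by congr shear; lia.
by apply/funext => k; congr shear; lia.
Qed.

(** The new term of [drift] cancels the part of the change of slope that varies inside a cell; only
    a function of the two centres remains. *)
Lemma tilt_coarser j x :
  tilt (j + m%:Z) x = tilt j x + omega (center j x) (center (j + m%:Z) x).
Proof.
rewrite /tilt drift_coarser /shear omegaBl !omegaBr.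
have : omega (center j x) (center j x) = - omega (center j x) (center j x).
  exact: omegaC.
lra.
Qed.

(** Centres have coordinates [2 ^ j * a / 2] and [2 ^ j * 2 ^+ m * b / 2] with integers [a], [b].
    The factor 2 in [omega] and one factor 2 of [2 ^+ m] absorb the denominator 4. *)
Lemma omega_center_int j x :
  omega (center j x) (center (j + m%:Z) x) / 2 ^ (2 * j) \is a Num.int.
Proof.
have D0 := exp2z_gt0 j; rewrite exp2zM2.
pose a k : R := (cell j x 0 k)%:~R * 2 + 1.
pose b k : R := (cell (j + m%:Z) x 0 k)%:~R * 2 + 1.
have aint k : a k \is a Num.int by rewrite /a rpredD ?rpredM ?intr_int ?rpred1 ?rpred_nat.
have bint k : b k \is a Num.int by rewrite /b rpredD ?rpredM ?intr_int ?rpred1 ?rpred_nat.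
have aE k : center j x 0 k = 2 ^ j * a k / 2 by rewrite /a !mxE; field.
have bE k : center (j + m%:Z) x 0 k = 2 ^ j * 2 ^+ m * b k / 2.
  by rewrite /b !mxE exp2zD; field.
have mE : (2 : R) ^+ m = 2 * 2 ^+ m.-1 by rewrite -exprS prednK//; lia.
rewrite /omega mulrAC mulr_sumr; apply: rpred_sum => k _; rewrite !aE !bE mE.
rewrite [X in X \in _](_ : _ = 2 ^+ m.-1 *
  (a (rshift n k) * b (lshift n k) - a (lshift n k) * b (rshift n k))).
  by rewrite rpredM ?rpredB ?rpredM ?rpredX ?rpred_nat.
by field; rewrite gt_eqF.
Qed.

(** * Integer codes of points and their coarsening *)

Definition code j (q : heis R n) : 'rV[int]_(n + n) * int :=
  let x := uncplx q.1 in
  (cell j x, Num.floor ((q.2 - tilt j x) / 2 ^ (2 * j))).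

Lemma codeP j q e : code j q = e <->
  cell j (uncplx q.1) = e.1 /\
  Num.floor ((q.2 - tilt j (uncplx q.1)) / 2 ^ (2 * j)) = e.2.
Proof. by split=> [<-|]; case: e => //= a b [<- <-]. Qed.

Definition node j (e : 'rV[int]_(n + n) * int) : 'rV[R]_(n + n) * R :=
  (corner j e.1, (2 : R) ^ (2 * j) * e.2%:~R).

Lemma node_inj j : injective (node j).
Proof.
move=> [a b] [a' b'] [/rowP aa' /(mulfI (lt0r_neq0 (exp2z_gt0 _))) bb'].
congr (_, _); last exact: (mulrIz (oner_neq0 R) bb').
apply/rowP => k; apply: (@intr_inj R).
by have := aa' k; rewrite !mxE => /(mulfI (lt0r_neq0 (exp2z_gt0 _))).
Qed.

Lemma lattice_node j p : lattice j p -> exists e, p = node j e.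
Proof. by case: p => [_ _] [[a _ /= <-] [b _ /= <-]]; exists (a, b). Qed.

Lemma code_coarser j q q' : code j q = code j q' ->
  code (j + m%:Z) q = code (j + m%:Z) q'.
Proof.
move=> qq'; have [cq' fq'] := (codeP j q' _).1 erefl.
have [] := (codeP j q _).1 qq'; rewrite -cq' -fq' => cqq' fqq'.
have cqq'm := cell_coarser cqq'.
apply/codeP; have [<- <-] := (codeP (j + m%:Z) q' _).1 erefl.
split; first exact: cqq'm.
have ceq : center j (uncplx q.1) = center j (uncplx q'.1).
  by rewrite /center cqq'.
have ceqm : center (j + m%:Z) (uncplx q.1) = center (j + m%:Z) (uncplx q'.1).
  by rewrite /center cqq'm.
(* The coarse height is the fine one, shifted by an integer common to both points and divided by
   [4 ^ m]. *)
have step (r : heis R n) c c' : center j (uncplx r.1) = c ->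
    center (j + m%:Z) (uncplx r.1) = c' ->
    Num.floor ((r.2 - tilt (j + m%:Z) (uncplx r.1)) / 2 ^ (2 * (j + m%:Z))) =
    Num.floor (((r.2 - tilt j (uncplx r.1)) / 2 ^ (2 * j) -
      omega c c' / 2 ^ (2 * j)) / (2 ^ (m * 2))%:R).
  move=> <- <-; congr Num.floor.
  rewrite tilt_coarser natrX exprM !exp2zM2 exp2zD.
  have := exp2z_gt0 j; have : (0 : R) < 2 ^+ m by rewrite exprn_gt0.
  by move=> /lt0r_neq0 mn /lt0r_neq0 jn; field; rewrite mn jn.
rewrite [LHS](step _ _ _ ceq ceqm) [RHS](step _ _ _ erefl erefl).
apply: floor_divn_congr; first by rewrite expn_gt0.
exact: floorBz_congr (omega_center_int j (uncplx q'.1)) fqq'.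
Qed.

Lemma code_coarser_iter j (k : nat) q q' : code j q = code j q' ->
  code (j + (k * m)%:Z) q = code (j + (k * m)%:Z) q'.
Proof.
move=> qq'; elim: k => [|k IH]; first by rewrite mul0n addr0.
rewrite (_ : j + (k.+1 * m)%:Z = j + (k * m)%:Z + m%:Z); first exact: code_coarser.
lia.
Qed.

(** * Geometry of the tiles *)

Definition tile j p : set (heis R n) := [set q | node j (code j q) = p].

(** All points of the fine tile share the fine code of a common point [q], hence also its coarse
    code. *)
Lemma tile_nested j (k : nat) p p' :
  tile j p `<=` tile (j + (k * m)%:Z) p' \/
  tile j p `&` tile (j + (k * m)%:Z) p' = set0.
Proof.
have [->|/set0P[q [qp qp']]] :=
  eqVneq (tile j p `&` tile (j + (k * m)%:Z) p') set0.
  by right.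
left=> r rp; apply: etrans qp'; apply: (congr1 (node _)).
by apply/code_coarser_iter/(@node_inj j); exact: etrans rp (esym qp).
Qed.

Lemma tile_proj j p : lattice j p ->
  [set q.1 | q in tile j p] = [set cplx x | x in cube j p.1].
Proof.
move=> /lattice_node[[a b] ->]; have D0 := exp2z_gt0 (2 * j).
apply/seteqP; split=> [_ [q qp <-]|_ [_ [y y0 <-] <-]].
  have /codeP[/cellP qa _] := node_inj qp.
  exists (uncplx q.1); last exact: uncplxK.
  by exists (uncplx q.1 - corner j a); rewrite ?subrK.
pose x := y + corner j a.
(* The point of the base of the tile above [x]. *)
exists (cplx x, 2 ^ (2 * j) * b%:~R + tilt j x) => //.
apply/(congr1 (node j))/codeP; rewrite [fst _]/= [snd _]/= cplxK; split.
  by apply/cellP => k; rewrite addrK.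
by rewrite addrK mulrAC divff ?gt_eqF// mul1r intrKfloor.
Qed.

(** Horizontally the ball stays within [2 ^ j / 2] of the centre of the cell. Vertically, the ball
    and [drift] contribute at most [4 ^ j / 4] each, the ball strictly less, so the point stays
    within half the height of the tile. *)
Lemma ball_sub_tile j p : lattice j p ->
  heis_ball (cplx (cube_center j p.1), p.2 + 1 / 2 * 2 ^ (2 * j))
    (1 / 2 * 2 ^ j) `<=` tile j p.
Proof.
move=> /lattice_node[[a b] ->] [z t]; have D0 := exp2z_gt0 j.
rewrite /heis_ball/= -(uncplxK z); set y := uncplx z; set P := cube_center _ _.
rewrite heis_dist_lt ?mulr_gt0//; set s := \sum_(_ < _) _; set w := _ - _ - _ => sw.
have s0 : 0 <= s by apply: sumr_ge0 => k _; rewrite sqr_ge0.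
have sD : s < (1 / 2 * 2 ^ j) ^+ 2.
  rewrite -(@ltr_pXn2r _ 2)// ?nnegrE ?exprn_ge0 ?mulr_ge0 ?(ltW D0)// -exprM.
  by apply: le_lt_trans sw; rewrite lerDl sqr_ge0.
have wD : `|w| < (1 / 2 * 2 ^ j) ^+ 2.
  rewrite -(@ltr_pXn2r _ 2)// ?nnegrE ?exprn_ge0 ?mulr_ge0 ?(ltW D0)// -exprM.
  by rewrite real_normK ?num_real//; apply: le_lt_trans sw; rewrite lerDr sqr_ge0.
have ya : cell j y = a.
  apply/cellP => k.
  have : (P - y) 0 k ^+ 2 < (1 / 2 * 2 ^ j) ^+ 2.
    apply: le_lt_trans sD; rewrite /s (bigD1 k)//= lerDl.
    by apply: sumr_ge0 => i _; rewrite sqr_ge0.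
  rewrite -real_normK ?num_real// ltr_pXn2r ?nnegrE ?mulr_ge0 ?(ltW D0)//.
  rewrite ltr_norml !mxE => /andP[]; lra.
have cy : center j y = P by rewrite /center ya.
have [_ dr] := drift_cvg j y.
apply/(congr1 (node j))/codeP; rewrite cplxK; split=> //.
apply: floor_def; rewrite exp2zM2 ler_pdivlMr ?ltr_pdivrMr ?exprn_gt0//.
rewrite /tilt cy omegaC.
move: wD dr; rewrite /w exp2zM2 intrD !ltr_norml ler_norml.
move=> /andP[? ?] /andP[? ?]; rewrite [(a, b).2]/= [(_, t).2]/=.
by apply/andP; split; lra.
Qed.

Lemma tile_sub_ball j p : lattice j p ->
  tile j p `<=`
  heis_ball (cplx (cube_center j p.1), p.2 + 1 / 2 * 2 ^ (2 * j))
    (n.+1%:R * 2 ^ j).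
Proof.
move=> /lattice_node[[a b] ->] [z t]; have D0 := exp2z_gt0 j.
move=> /node_inj/codeP; rewrite /heis_ball/= -(uncplxK z); set y := uncplx z.
rewrite cplxK => -[ya tb]; set P := cube_center _ _.
have cy : center j y = P by rewrite /center ya.
rewrite heis_dist_lt ?mulr_gt0//; set s := \sum_(_ < _) _; set w := _ - _ - _.
have s0 : 0 <= s by apply: sumr_ge0 => k _; rewrite sqr_ge0.
have sD : s <= n%:R / 2 * (2 ^ j) ^+ 2.
  have -> : n%:R / 2 * (2 ^ j) ^+ 2 = \sum_(k < n + n) (2 ^ j / 2) ^+ 2 :> R.
    by rewrite sumr_const card_ord -[RHS]mulr_natr natrD; field.
  apply: ler_sum => k _; rewrite -cy -real_normK ?num_real//.
  rewrite lerXn2r ?nnegrE ?divr_ge0 ?(ltW D0)// -normrN.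
  by have := center_ler j y k; rewrite !mxE opprB.
have [_ dr] := drift_cvg j y.
(* Half the height of the tile plus a quarter for [drift]. *)
have wD : `|w| <= 3 / 4 * (2 ^ j) ^+ 2.
  have := floor_itv ((t - tilt j y) / 2 ^ (2 * j)); rewrite tb.
  rewrite exp2zM2 ler_pdivlMr ?ltr_pdivrMr ?exprn_gt0//.
  rewrite /tilt cy omegaC.
  move: dr; rewrite /w exp2zM2 intrD !ler_norml.
  by move=> /andP[? ?] /andP[? ?]; lra.
have D2 : 0 < ((2 : R) ^ j) ^+ 2 by rewrite exprn_gt0.
have s2 : s ^+ 2 <= (n%:R / 2 * (2 ^ j) ^+ 2) ^+ 2.
  by rewrite lerXn2r ?nnegrE// (le_trans s0).
have w2 : w ^+ 2 <= (3 / 4 * (2 ^ j) ^+ 2) ^+ 2.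
  by rewrite -real_normK ?num_real// lerXn2r ?nnegrE// (le_trans _ wD).
apply: (le_lt_trans (lerD s2 w2)).
rewrite -natr1; set D := (2 ^ j) ^+ 2; set N : R := n%:R.
have N0 : 0 <= N by [].
rewrite [ltRHS](_ : _ = (N + 1) ^+ 4 * D ^+ 2); last by rewrite /D; ring.
rewrite [ltLHS](_ : _ = ((N / 2) ^+ 2 + (3 / 4) ^+ 2) * D ^+ 2); last by ring.
rewrite ltr_pM2r ?exprn_gt0//.
(* The remaining goal is [N ^+ 2 / 4 + 9 / 16 < (N + 1) ^+ 4]; this bound makes it linear in [N] and
   [N ^+ 2]. *)
have : N ^+ 2 <= (N + 1) ^+ 4 - 1 - 4 * N.
  rewrite -subr_ge0 (_ : _ - _ = N ^+ 4 + 4 * N ^+ 3 + 5 * N ^+ 2); last by ring.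
  by rewrite !addr_ge0 ?mulr_ge0 ?exprn_ge0.
have := sqr_ge0 N; lra.
Qed.

End Tiling.

(** * Assembly of the five properties *)

Theorem theorem22 (R : realType) (n : nat) :
  exists (m : nat) (C1 C2 : R), [/\ (0 < m)%N, 0 < C1, 0 < C2 &
  exists (S : int -> 'rV[R]_(n + n) * R -> set (heis R n))
         (c : int -> 'rV[R]_(n + n) * R -> heis R n),
  [/\ (* (1) *)
      forall j : int, (m%:Z %| j)%Z ->
        \bigcup_(p in lattice j) S j p = [set: heis R n] /\
        trivIset (lattice j) (S j),
      (* (2) *)
      forall (j : int) (p : 'rV[R]_(n + n) * R), (m%:Z %| j)%Z -> lattice j p ->
        [set q.1 | q in S j p] = [set cplx x | x in cube j p.1],
      (* (3) *)
      forall (j : int) (p : 'rV[R]_(n + n) * R), (m%:Z %| j)%Z -> lattice j p ->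
        heis_ball (c j p) (C1 * 2 ^ j) `<=` S j p /\
        S j p `<=` heis_ball (c j p) (C2 * 2 ^ j),
      (* (4) *)
      forall (j j' : int) (p p' : 'rV[R]_(n + n) * R),
        (m%:Z %| j)%Z -> lattice j p -> (m%:Z %| j')%Z -> lattice j' p' ->
        [\/ S j p `<=` S j' p', S j' p' `<=` S j p |
            S j p `&` S j' p' = set0]
    & (* (5) *)
      forall (j : int) (p : 'rV[R]_(n + n) * R), (m%:Z %| j)%Z -> lattice j p ->
        c j p = (cplx (cube_center j p.1), p.2 + 1 / 2 * 2 ^ (2 * j))]].
Proof.
pose m := (n + 4)%N; have mm : (n + 4 <= m)%N by [].
exists m, (1 / 2), n.+1%:R; split; [by rewrite /m; lia|by []|by []|].
exists (tile m), (fun j p => (cplx (cube_center j p.1), p.2 + 1 / 2 * 2 ^ (2 * j))).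
split.
- move=> j _; split; last by move=> p p' _ _ [q [<- <-]].
  apply/seteqP; split=> // q _; exists (node R j (code m j q)) => //.
- by move=> j p _; exact: tile_proj.
- by move=> j p _ pj; split; [exact: ball_sub_tile|exact: tile_sub_ball].
(* Two admissible scales differ by a multiple of [m], so ordering them reduces (4) to iterated
   coarsening. *)
- have nest (i i' : int) (r r' : 'rV[R]_(n + n) * R) :
      (m%:Z %| i)%Z -> (m%:Z %| i')%Z -> i <= i' ->
      tile m i r `<=` tile m i' r' \/ tile m i r `&` tile m i' r' = set0.
    move=> mi mi' ii'; have /dvdzP[k kE] := rpredB mi' mi.
    have k0 : 0 <= k by rewrite /m in kE; nia.
    rewrite (_ : i' = i + (`|k|%N * m)%:Z); first exact: tile_nested.
    by rewrite PoszM gez0_abs// -kE; lia.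
  move=> j j' p p' mj _ mj' _; have [jj'|/ltW j'j] := leP j j'.
    by have [|] := nest _ _ p p' mj mj' jj'; [apply: Or31|apply: Or33].
  have [|] := nest _ _ p' p mj' mj j'j; first by move=> ?; apply: Or32.
  by rewrite setIC => ?; apply: Or33.
- by [].
Qed.
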